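(* Let $d(x,y)=g(|x-y|)$ for $x,y\in\mathbf{R}$, where $g:[0,\infty)\to[0,\infty)$ is strictly concave with $g(x)=0$ if and only if $x=0$. Let $X=\{x_i\}_{1\le i\le 2n}$ with $x_1<x_2<\dots<x_{2n}$ and $X'=\{x'_{i'}\}_{1\le i'\le 2n'}$ with $x'_1<x'_2<\dots<x'_{2n'}$ be two sets of points of $\mathbf{R}$ such that $x_{2n}<x'_1$, i.e., $X'$ lies to the right of $X$. Refer to the minimum-weight perfect matchings on $X$ and on $X'$ as partial matchings and to the minimum-weight perfect matching on $X\cup X'$ as the joint matching. Then whenever an arc $(x_i,x_j)$ is hidden in the partial matching on $X$, it belongs to the joint matching and is hidden there too; respectively, whenever an arc $(x'_{i'},x'_{j'})$ is hidden in the partial matching on $X'$, it belongs to the joint matching and is hidden there too.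
   Context: Strict concavity of $g$ means $g(\lambda x+(1-\lambda)y)>\lambda g(x)+(1-\lambda)g(y)$ for all $x,y\ge 0$ with $x\ne y$ and all $0<\lambda<1$. A perfect matching on a finite set $S\subset\mathbf{R}$ of even cardinality is a set of mutually disjoint edges (called arcs) of the complete graph on $S$ that involves all points of $S$; an arc connecting $a$ to $b$ is written $(a,b)$ and has weight $d(a,b)$. The weight of a matching is the sum of the weights of its arcs; a minimum-weight perfect matching on $S$ is a perfect matching on $S$ of minimal weight. A matching is nested if, for any two of its arcs, the corresponding intervals in $\mathbf{R}$ are either disjoint or one of them is contained in the other; for the distances considered here a minimum-weight perfect matching is nested. An arc $(a,b)$ of a nested matching is exposed if it is not contained in any other arc, i.e., if there is no other arc $(a',b')$ of the matching with $a,b$ contained between $a'$ and $b'$; all other arcs of the nested matching are called hidden.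
   Formalization: Minimum-weight matchings may tie, and the claim then fails for arbitrary choices; proved: if the partial matching is unique, its hidden arcs are hidden in every minimal joint matching; in general, for any minimal partial matchings some minimal joint matching contains and hides all their hidden arcs. *)

(* Defs.v *)
From HB Require Import structures.
From mathcomp Require Import all_boot all_order all_algebra finmap reals.

Set Implicit Arguments.
Unset Strict Implicit.
Unset Printing Implicit Defensive.

Import Order.TTheory GRing.Theory Num.Theory.
Local Open Scope fset_scope.
Local Open Scope ring_scope.

Definition strictly_concave (R : realType) (g : R -> R) : Prop :=
  forall x y l : R, 0 <= x -> 0 <= y -> x != y -> 0 < l < 1 ->
    l * g x + (1 - l) * g y < g (l * x + (1 - l) * y).

Definition line_dist (R : realType) (g : R -> R) (x y : R) : R := g `|x - y|.

(* An (undirected) arc is represented by the pair of its endpoints, the       *)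
(* smaller one first; [perfect_matching] enforces this normal form, so that   *)
(* sets of pairs faithfully represent sets of edges of the complete graph.    *)
Definition endpoints (R : realType) (e : R * R) : {fset R} := [fset e.1; e.2].

Definition perfect_matching (R : realType) (S : {fset R}) (M : {fset R * R})
    : Prop :=
  [/\ forall e, e \in M -> [/\ e.1 \in S, e.2 \in S & e.1 < e.2],
      forall e f, e \in M -> f \in M -> e != f ->
        [disjoint endpoints e & endpoints f] &
      forall s, s \in S -> exists2 e, e \in M & s \in endpoints e].

Definition weight (R : realType) (d : R -> R -> R) (M : {fset R * R}) : R :=
  \sum_(e <- M) d e.1 e.2.

Definition min_perfect_matching (R : realType) (d : R -> R -> R)
    (S : {fset R}) (M : {fset R * R}) : Prop :=
  perfect_matching S M /\
  forall N, perfect_matching S N -> weight d M <= weight d N.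

Definition exposed (R : realType) (M : {fset R * R}) (e : R * R) : Prop :=
  e \in M /\
  ~ exists f, [/\ f \in M, f != e, f.1 <= e.1 <= f.2 & f.1 <= e.2 <= f.2].

Definition hidden (R : realType) (M : {fset R * R}) (e : R * R) : Prop :=
  e \in M /\ ~ exposed M e.

Definition point_set (R : realType) (m : nat) (x : 'I_m -> R) : {fset R} :=
  [fset x i | i : 'I_m].

(* Main.v *)
Require Import Defs.
From HB Require Import structures.
From mathcomp Require Import all_boot all_order all_algebra finmap reals.
From mathcomp Require Import boolp zify ring lra.

Set Implicit Arguments.
Unset Strict Implicit.
Unset Printing Implicit Defensive.

Import Order.TTheory GRing.Theory Num.Theory.
Local Open Scope fset_scope.
Local Open Scope ring_scope.

(* Strict concavity makes [g] strictly increasing and makes a minimum-weight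
   matching nested, since uncrossing two arcs lowers the weight. Let [(P, Q)] be
   an exposed arc of a partial matching [M], and let the joint matching [J] have
   arcs [c_1 -> y_1, ..., c_k -> y_k] leaving [[P, Q]], with [c_1 < ... < c_k];
   [k] is even. Using monotonicity and uncrossing only,
     d(P,Q) + sum_i d(c_i,y_i) >= d(c_1,c_2) + ... + d(c_(k-1),c_k)
         + d(P,y_1) + d(y_2,y_3) + ... + d(y_k,Q),
   strictly unless [k = 0] or [k = 2, c_1 = P, c_2 = Q]. A strict inequality
   contradicts the minimality of [M] or that of [J]: replace the arcs of [M] in
   [[P, Q]] by those of [J] and the [(c_i, c_(i+1))], and the arcs of [J] there
   by the other arcs of [M] and those of the last row. Hence [J] matches among
   themselves the points of [[P, Q]], or those of its interior, and there [M]
   and [J] can be exchanged at equal weight. *)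

(** * Monotonicity and uncrossing for concave distances *)

Section ConcaveDistance.
Context (R : realType) (g : R -> R).
Hypothesis g_ge0 : forall t : R, 0 <= t -> 0 <= g t.
Hypothesis g_concave : strictly_concave g.
Hypothesis g_eq0 : forall t : R, 0 <= t -> (g t = 0 <-> t = 0).

Let d := line_dist g.

Lemma line_distC a b : d a b = d b a.
Proof. by rewrite /d /line_dist distrC. Qed.

Lemma line_dist_le a b : a <= b -> d a b = g (b - a).
Proof. by move=> ab; rewrite /d /line_dist distrC ger0_norm ?subr_ge0. Qed.

(** [u] and [v] are convex combinations of [a] and [b] with the weights [l] and [1 - l]
    interchanged; the two concavity inequalities add up to the claim. *)
Lemma concave_sum_lt (a b u v : R) :
  0 <= a -> a < u -> a < v -> u + v = a + b -> g a + g b < g u + g v.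
Proof.
move=> a0 au av uv.
have ab : a < b by lra.
pose l := (v - a) / (b - a).
have ba0 : b - a != 0 by rewrite subr_eq0 gt_eqF.
have lE : l * (b - a) = v - a by rewrite /l divfK.
have l01 : 0 < l < 1.
  by rewrite /l divr_gt0 ?subr_gt0//= ltr_pdivrMr ?subr_gt0// mul1r; lra.
have l01' : 0 < 1 - l < 1 by lra.
have b0 : 0 <= b by lra.
have h1 := g_concave a0 b0 (negbT (lt_eqF ab)) l01.
have h2 := g_concave a0 b0 (negbT (lt_eqF ab)) l01'.
have e1 : l * a + (1 - l) * b = u by nra.
have e2 : (1 - l) * a + (1 - (1 - l)) * b = v by nra.
rewrite e1 in h1; rewrite e2 in h2.
have -> : g a + g b = (l * g a + (1 - l) * g b) +
   ((1 - l) * g a + (1 - (1 - l)) * g b) by ring.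
lra.
Qed.

(* A nonnegative function that decreased between [a] and [b] would, by
   concavity, become negative at [a + (b - a) / m], where [m] is the relative
   drop of [g]. *)
Lemma concave_ge0_le (a b : R) : 0 <= a -> a < b -> g a <= g b.
Proof.
move=> a0 ab; rewrite leNgt; apply/negP => gba.
have gb0 : 0 < g b.
  rewrite lt_neqAle g_ge0 ?andbT; last lra.
  by apply/eqP => /esym/g_eq0 h; have := h ltac:(lra); lra.
have ga0 : 0 < g a by lra.
pose m := (g a - g b) / g a.
have mE : m * g a = g a - g b by rewrite /m divfK// gt_eqF.
have m0 : 0 < m by rewrite /m divr_gt0// subr_gt0.
have m1 : m < 1 by rewrite /m ltr_pdivrMr// mul1r; lra.
pose t := a + (b - a) / m.
have tE : m * (t - a) = b - a.
  by rewrite /t addrAC subrr add0r mulrC divfK// gt_eqF.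
have ta : a < t by rewrite -subr_gt0 /t addrAC subrr add0r divr_gt0// subr_gt0.
have m01 : 0 < 1 - m < 1 by lra.
have t0 : 0 <= t by lra.
have := g_concave a0 t0 (negbT (lt_eqF ta)) m01.
have -> : (1 - m) * a + (1 - (1 - m)) * t = b by nra.
have := g_ge0 t0; nra.
Qed.

(** If [g a = g b], strict concavity would lift the midpoint above [g b], against weak
    monotonicity. *)
Lemma concave_ge0_lt (a b : R) : 0 <= a -> a < b -> g a < g b.
Proof.
move=> a0 ab; have := concave_ge0_le a0 ab.
rewrite le_eqVlt => /orP[/eqP gab|//].
have l01 : 0 < (2^-1 : R) < 1 by lra.
have b0 : 0 <= b by lra.
have := g_concave a0 b0 (negbT (lt_eqF ab)) l01.
set c := 2^-1 * a + _ => h.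
have cb : c < b by rewrite /c; lra.
have c0 : 0 <= c by rewrite /c; lra.
have := concave_ge0_le c0 cb; lra.
Qed.

Lemma line_dist_lt (a b a' b' : R) :
  a' <= a -> a <= b -> b <= b' -> b - a < b' - a' -> d a b < d a' b'.
Proof.
move=> ? ? ? ?; rewrite !line_dist_le; try lra.
by apply: concave_ge0_lt; lra.
Qed.

(** Both pairs of arcs have the same total length, and the crossing lengths lie strictly between the
    nested ones. *)
Lemma line_dist_uncross (p q r s : R) :
  p < q -> q <= r -> r < s -> d p s + d q r < d p r + d q s.
Proof.
move=> pq qr rs; rewrite !line_dist_le; try lra.
by rewrite addrC; apply: concave_sum_lt; lra.
Qed.

End ConcaveDistance.

(** * Matchings as lists of endpoints, and swaps of arcs between matchings *)

Section ArcSequences.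
Context (R : realType).
Implicit Types (L : seq (R * R)) (S X : {fset R}) (M : {fset R * R}).

(** Multiplicities are kept, so that [perm_eq (ends L) S] expresses disjointness and covering at
    once and rearrangements of arcs are checked by counting. *)
Fixpoint ends L : seq R :=
  if L is e :: L' then [:: e.1, e.2 & ends L'] else [::].

Lemma ends_cat L1 L2 : ends (L1 ++ L2) = ends L1 ++ ends L2.
Proof. by elim: L1 => //= e L1 ->. Qed.

Lemma size_ends L : size (ends L) = (size L).*2.
Proof. by elim: L => //= e L IH; rewrite IH. Qed.

Lemma mem_ends L z : (z \in ends L) = has (fun e => z \in [:: e.1; e.2]) L.
Proof. by elim: L => //= e L IH; rewrite !inE IH orbA. Qed.

Lemma mem_endsP L z :
  reflect (exists2 e, e \in L & (z == e.1) || (z == e.2)) (z \in ends L).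
Proof.
rewrite mem_ends; apply: (iffP hasP) => -[e eL];
by rewrite ?inE => ?; exists e; rewrite // !inE.
Qed.

Lemma mem_ends1 L e : e \in L -> e.1 \in ends L.
Proof. by move=> eL; apply/mem_endsP; exists e; rewrite ?eqxx. Qed.

Lemma mem_ends2 L e : e \in L -> e.2 \in ends L.
Proof. by move=> eL; apply/mem_endsP; exists e; rewrite ?eqxx ?orbT. Qed.

Lemma perm_ends L1 L2 : perm_eq L1 L2 -> perm_eq (ends L1) (ends L2).
Proof.
have endsE L : ends L = flatten [seq [:: e.1; e.2] | e <- L].
  by elim: L => //= e L ->.
by move=> h; rewrite !endsE; apply: perm_flatten; apply: perm_map.
Qed.

Lemma uniq_ends_uniq L : uniq (ends L) -> uniq L.
Proof.
elim: L => //= e L IH; move=> /and3P[e1 _ /IH ->].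
rewrite andbT; apply: contra e1 => eL; rewrite inE; apply/orP; right.
exact: mem_ends1.
Qed.

Lemma perm_rem2 (T : eqType) (L : seq T) e f : e \in L -> f \in L -> e != f ->
  perm_eq L [:: e, f & rem f (rem e L)].
Proof.
move=> eL fL ef; apply: perm_trans (perm_to_rem eL) _; rewrite perm_cons.
apply: perm_to_rem; have := fL; rewrite (perm_mem (perm_to_rem eL)) inE.
by rewrite eq_sym (negbTE ef).
Qed.

Lemma uniq_ends2 L e f : uniq (ends L) -> e \in L -> f \in L -> e != f ->
  uniq [:: e.1; e.2; f.1; f.2].
Proof.
move=> uL eL fL ef; have := uL.
rewrite (perm_uniq (perm_ends (perm_rem2 eL fL ef))).
by rewrite (cat_uniq [:: e.1; e.2; f.1; f.2]) => /andP[].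
Qed.

Lemma uniq_ends_inj L e f z : uniq (ends L) -> e \in L -> f \in L ->
  z \in [:: e.1; e.2] -> z \in [:: f.1; f.2] -> e = f.
Proof.
move=> uL eL fL ze zf; apply/eqP; apply/negPn/negP => ef.
have := uniq_ends2 uL eL fL ef; rewrite (cat_uniq [:: e.1; e.2]).
by case/and3P => _ /hasPn/(_ z zf); rewrite /= ze.
Qed.

Lemma perfect_matchingP S M : perfect_matching S M <->
  (forall e, e \in M -> e.1 < e.2) /\ perm_eq (ends M) S.
Proof.
split=> [[MS Mdisj Mcov]|[Mlt MS]].
  split=> [e /MS[]//|]; apply: uniq_perm; rewrite ?fset_uniq//.
    have : forall e, e \in enum_fset M -> e \in M by [].
    have := fset_uniq M; elim: (enum_fset M) => //= e L IH /andP[eL uL] LM.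
    have eM : e \in M by apply: LM; rewrite inE eqxx.
    have /IH -> // : forall f, f \in L -> f \in M.
      by move=> f fL; apply: LM; rewrite inE fL orbT.
    have eN z : z \in [:: e.1; e.2] -> z \notin ends L.
      rewrite !inE => ze; apply/mem_endsP => -[f fL zf].
      have fM : f \in M by apply: LM; rewrite inE fL orbT.
      have ef : e != f by apply: contraNneq eL => ->.
      have /fdisjointP/(_ z) := Mdisj _ _ eM fM ef.
      by rewrite !inE ze zf => /(_ isT).
    rewrite inE negb_or !eN ?inE ?eqxx ?orbT// !andbT.
    by have [_ _ /lt_eqF->] := MS _ eM.
  move=> z; apply/mem_endsP/idP => [[e /MS[e1 e2 _]] /orP[]/eqP->//|].
  move=> /Mcov[e eM].
  by rewrite !inE => ze; exists e.
have uM : uniq (ends M) by rewrite (perm_uniq MS) fset_uniq.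
have memS z : (z \in S) = (z \in ends M) by rewrite (perm_mem MS).
split=> [e eM|e f eM fM ef|s].
- by split; rewrite ?memS ?mem_ends1 ?mem_ends2 ?Mlt.
- apply/fdisjointP => z; rewrite !inE => ze; apply/negP => zf.
  move/eqP: ef; apply; apply: (uniq_ends_inj uM eM fM (z := z));
  by rewrite !inE.
- by rewrite memS => /mem_endsP[e eM ez]; exists e => //; rewrite !inE.
Qed.

Lemma perfect_matching_seq_fset S L : (forall e, e \in L -> e.1 < e.2) ->
  perm_eq (ends L) S ->
  perfect_matching S [fset e in L] /\ perm_eq [fset e in L] L.
Proof.
move=> Llt LS.
have pL : perm_eq [fset e in L] L.
  apply: uniq_perm; rewrite ?fset_uniq//.
    by apply: uniq_ends_uniq; rewrite (perm_uniq LS) fset_uniq.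
  by move=> z; rewrite in_fset.
split=> //; apply/perfect_matchingP; split=> [e|].
  by rewrite in_fset; apply: Llt.
exact: perm_trans (perm_ends pL) LS.
Qed.

Lemma size_filter_ends_even (p : pred R) L S :
  perm_eq (ends L) S -> (forall e, e \in L -> p e.1 = p e.2) ->
  ~~ odd (size (filter p S)).
Proof.
move=> LS Lp; rewrite -(perm_size (perm_filter p LS)).
elim: L Lp {LS} => //= e L IH Lp; rewrite -(Lp e) ?inE ?eqxx//.
have {}IH : ~~ odd (size (filter p (ends L))).
  by apply: IH => f fL; apply: Lp; rewrite inE fL orbT.
by case: (p e.1) => //=; rewrite negbK.
Qed.

Lemma filter_ends_closed (p : pred R) L :
  (forall e, e \in L -> p e.1 = p e.2) ->
  filter p (ends L) = ends [seq e <- L | p e.1].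
Proof.
elim: L => //= e L IH Lp; rewrite -(Lp e) ?inE ?eqxx// IH; last first.
  by move=> f fL; apply: Lp; rewrite inE fL orbT.
by case: (p e.1).
Qed.

Definition inner_arcs (p : pred R) L := [seq e <- L | p e.1 && p e.2].
Definition outer_arcs (p : pred R) L := [seq e <- L | ~~ p e.1 && ~~ p e.2].
(** The arcs are reoriented to start inside [p], so that [unzip1] and [unzip2] separate inner from
    outer ends. *)
Definition crossing_arcs (p : pred R) L :=
  [seq (if p e.1 then e else (e.2, e.1)) | e <- L & p e.1 != p e.2].

Lemma count_ends_in (p : pred R) L a :
  count a (filter p (ends L)) =
  (count a (ends (inner_arcs p L)) + count a (unzip1 (crossing_arcs p L)))%N.
Proof.
rewrite /inner_arcs /crossing_arcs; elim: L => //= e L.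
by case p1: (p e.1); case p2: (p e.2); rewrite /= ?p1 ?p2 /=; lia.
Qed.

Lemma count_ends_out (p : pred R) L a :
  count a (filter (predC p) (ends L)) =
  (count a (ends (outer_arcs p L)) + count a (unzip2 (crossing_arcs p L)))%N.
Proof.
rewrite /outer_arcs /crossing_arcs; elim: L => //= e L.
by case p1: (p e.1); case p2: (p e.2); rewrite /= ?p1 ?p2 /=; lia.
Qed.

Lemma crossing_arcsP (p : pred R) L c : c \in crossing_arcs p L ->
  [/\ p c.1, ~~ p c.2 & c \in L \/ (c.2, c.1) \in L].
Proof.
case/mapP => e; rewrite mem_filter => /andP[+ eL] ->.
case p1: (p e.1); case p2: (p e.2) => //= _; rewrite ?p1 ?p2; split=> //.
  by left.
by right; case: e eL {p1 p2}.
Qed.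

Variable d : R -> R -> R.

Section Symmetric.
Hypothesis dC : forall a b, d a b = d b a.

Lemma weight_split (p : pred R) L : \sum_(e <- L) d e.1 e.2 =
  \sum_(e <- inner_arcs p L) d e.1 e.2 +
  \sum_(e <- crossing_arcs p L) d e.1 e.2 +
  \sum_(e <- outer_arcs p L) d e.1 e.2.
Proof.
rewrite /inner_arcs /outer_arcs /crossing_arcs.
elim: L => [|e L IH]; first by rewrite !big_nil !addr0.
rewrite big_cons IH /=; case p1: (p e.1); case p2: (p e.2) => /=;
by rewrite ?p1 !big_cons/= ?(dC e.2); ring.
Qed.

(** Competitors may have unoriented arcs: [norm] reorders their ends at no cost as [d] is symmetric,
    and no arc is degenerate because [ends L] has no repetition. *)
Lemma min_perfect_matching_le S M L : min_perfect_matching d S M ->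
  perm_eq (ends L) S -> weight d M <= \sum_(e <- L) d e.1 e.2.
Proof.
move=> [_ Mmin] LS.
pose norm (e : R * R) := if e.1 < e.2 then e else (e.2, e.1).
pose L' := map norm L.
have L'L : perm_eq (ends L') (ends L).
  apply/permP => a; rewrite /L'; elim: (L) => //= e l; rewrite /norm.
  by case: ifP => _ /=; lia.
have wL : \sum_(e <- L') d e.1 e.2 = \sum_(e <- L) d e.1 e.2.
  by rewrite big_map; apply: eq_bigr => e _; rewrite /norm; case: ifP => //= _.
have L'S := perm_trans L'L LS.
have L'lt e : e \in L' -> e.1 < e.2.
  case/mapP => f fL ->; rewrite /norm; case: (ltP f.1 f.2) => //=.
  rewrite le_eqVlt.
  case/orP => [/eqP f12|//].
  have : uniq (ends L) by rewrite (perm_uniq LS) fset_uniq.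
  rewrite (perm_uniq (perm_ends (perm_to_rem fL))) /= inE f12 eqxx.
  by [].
have [NS Np] := perfect_matching_seq_fset L'lt L'S.
by rewrite -wL -(perm_big _ Np); apply: Mmin.
Qed.

End Symmetric.

Section Swap.
Variables (S X : {fset R}) (J M : {fset R * R}) (q : pred R).
Hypothesis JS : perfect_matching S J.
Hypothesis MX : perfect_matching X M.
Hypothesis Jq : forall e, e \in J -> q e.1 = q e.2.
Hypothesis Mq : forall e, e \in M -> q e.1 = q e.2.
Hypothesis SX : forall z, q z -> (z \in S) = (z \in X).

Definition swap_arcs (A B : {fset R * R}) : {fset R * R} :=
  [fset e in [seq e <- A | ~~ q e.1] ++ [seq e <- B | q e.1]].

Lemma swap_matching : perfect_matching S (swap_arcs J M) /\
  weight d (swap_arcs J M) + \sum_(e <- J | q e.1) d e.1 e.2 =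
  weight d J + \sum_(e <- M | q e.1) d e.1 e.2.
Proof.
have [Jlt JE] := (perfect_matchingP S J).1 JS.
have [Mlt ME] := (perfect_matchingP X M).1 MX.
have SXq : perm_eq (filter q S) (filter q X).
  apply: uniq_perm; rewrite ?filter_uniq ?fset_uniq// => z.
  by rewrite !mem_filter; case qz: (q z) => //=; apply: SX.
have LS : perm_eq (ends ([seq e <- J | ~~ q e.1] ++ [seq e <- M | q e.1])) S.
  rewrite ends_cat -(filter_ends_closed Mq).
  have -> : ends [seq e <- J | ~~ q e.1] = filter (predC q) (ends J).
    by rewrite filter_ends_closed// => e /Jq /= ->.
  apply/permP => a; rewrite count_cat.
  have /permP/(_ a) -> := perm_filter (predC q) JE.
  have /permP/(_ a) -> := perm_filter q ME.
  have /permP/(_ a) <- := SXq.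
  have /permP/(_ a) := permEl (perm_filterC q S).
  by rewrite count_cat => <-; rewrite addnC.
have [e|Sm Sp] := perfect_matching_seq_fset _ LS.
  by rewrite mem_cat !mem_filter => /orP[]/andP[_]; [apply: Jlt|apply: Mlt].
split=> //; rewrite /weight (perm_big _ Sp) big_cat !big_filter/=.
by rewrite [X in _ = X + _](bigID (fun e => q e.1))/=; ring.
Qed.

Lemma mem_swap_arcs A B e :
  (e \in swap_arcs A B) = (e \in (if q e.1 then B else A)).
Proof.
by rewrite in_fset mem_cat !mem_filter; case: (q e.1); rewrite /= ?orbF.
Qed.

End Swap.

(** Exchanging the arcs inside [q] changes the weights of [J] and [M] by opposite amounts. Neither
    change can be negative, so both vanish. *)
Lemma swap_min_matching S X J M (q : pred R) :
  min_perfect_matching d S J -> min_perfect_matching d X M ->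
  (forall e, e \in J -> q e.1 = q e.2) ->
  (forall e, e \in M -> q e.1 = q e.2) ->
  (forall z, q z -> (z \in S) = (z \in X)) ->
  min_perfect_matching d S (swap_arcs q J M).
Proof.
move=> [JS Jmin] [MX Mmin] Jq Mq SX.
have XS z (qz : q z) := esym (SX z qz).
have [NS NSw] := swap_matching JS MX Jq Mq SX.
have [NX NXw] := swap_matching MX JS Mq Jq XS.
have := Mmin _ NX; have := Jmin _ NS => hS hX.
by split=> // N /Jmin; lra.
Qed.

End ArcSequences.

(** * Exchange along the arcs that leave an exposed interval *)

Section Exchange.
Context (R : realType) (g : R -> R).
Hypothesis g_ge0 : forall t : R, 0 <= t -> 0 <= g t.
Hypothesis g_concave : strictly_concave g.
Hypothesis g_eq0 : forall t : R, 0 <= t -> (g t = 0 <-> t = 0).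
Let d := line_dist g.
Let dC : forall a b, d a b = d b a := line_distC g.
Let d_lt := line_dist_lt g_ge0 g_concave g_eq0.
Let d_uncross := line_dist_uncross g_concave.
Implicit Types (S X : {fset R}) (J M : {fset R * R}).

Lemma min_matching_noncrossing S J e f : min_perfect_matching d S J ->
  e \in J -> f \in J -> ~ (e.1 < f.1 /\ f.1 < e.2 /\ e.2 < f.2).
Proof.
move=> Jmin eJ fJ [ef [fe1 ef2]].
have [Jlt JS] := (perfect_matchingP S J).1 Jmin.1.
have nef : e != f by apply: contraTneq ef => ->; rewrite ltxx.
have pJ := perm_rem2 eJ fJ nef.
set L := rem f _ in pJ.
have := min_perfect_matching_le dC (L := [:: (e.1, f.2), (f.1, e.2) & L]) Jmin.
rewrite /weight (perm_big _ pJ) !big_cons/=.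
have -> : perm_eq [:: e.1, f.2, f.1, e.2 & ends L] S.
  apply: perm_trans JS; rewrite perm_sym.
  apply: perm_trans (perm_ends pJ) _.
  by clear; apply/permP => a /=; lia.
by move=> /(_ isT); have := d_uncross ef (ltW fe1) ef2; rewrite -/d; lra.
Qed.

Section Chain.
Variables P Q : R.

(* Constraint on the outer endpoints of two consecutive arcs leaving [P, Q],
   ordered by their inner endpoints, imposed by the absence of crossings. *)
Definition outer_rel (y y' : R) : bool :=
  if Q < y then Q < y' < y else (y' < y) || (Q < y').

Definition leaving_rel : rel (R * R) :=
  fun e f => (e.1 < f.1) && outer_rel e.2 f.2.

(** If [y0 <= P] and [Q < y], this is an uncrossing; in the other cases allowed by [outer_rel], each
    new arc lies inside an old one and monotonicity suffices. *)
Lemma exchange_outer y0 c y : y0 <= P \/ Q < y0 -> P <= c < Q ->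
  y < P \/ Q < y -> outer_rel y0 y ->
  d y0 y + d c Q <= d Q y0 + d c y /\
  (c != y0 -> d y0 y + d c Q < d Q y0 + d c y).
Proof.
move=> y0P /andP[Pc cQ] yPQ r.
suff h : c != y0 -> d y0 y + d c Q < d Q y0 + d c y.
  split=> //; have [->|/h/ltW//] := eqVneq c y0.
  by rewrite (dC Q) addrC.
move=> ncy; move: r; rewrite /outer_rel.
case: (ltP Q y0) => [Qy0 /andP[Qy yy0]|y0Q].
  have := @d_lt y y0 Q y0 ltac:(lra) ltac:(lra) ltac:(lra) ltac:(lra).
  have := @d_lt c Q c y ltac:(lra) ltac:(lra) ltac:(lra) ltac:(lra).
  by rewrite -/d (dC y0 y); lra.
have {}y0P : y0 <= P by case: y0P => //; lra.
have y0c : y0 < c by rewrite lt_neqAle eq_sym ncy; lra.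
case/orP => [yy0|Qy].
  have := @d_lt y y0 y c ltac:(lra) ltac:(lra) ltac:(lra) ltac:(lra).
  have := @d_lt c Q y0 Q ltac:(lra) ltac:(lra) ltac:(lra) ltac:(lra).
  by rewrite -/d (dC y0 y) (dC Q) (dC c y); lra.
have := d_uncross y0c (ltW cQ) Qy.
by rewrite -/d (dC Q); lra.
Qed.

(** For [y < P] the crossing arcs [(y, c')] and [(c, Q)] are uncrossed; for [Q < y] each new arc
    lies inside an old one. *)
Lemma exchange_inner c c' y : P <= c -> c < c' -> c' <= Q ->
  y < P \/ Q < y ->
  d c c' + d Q y <= d c Q + d c' y /\
  (c' != Q -> d c c' + d Q y < d c Q + d c' y).
Proof.
move=> Pc cc' c'Q yPQ.
suff h : c' != Q -> d c c' + d Q y < d c Q + d c' y.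
  by split=> //; have [->//|/h/ltW//] := eqVneq c' Q.
move=> nc'; have {}c'Q : c' < Q by rewrite lt_neqAle nc'.
case: yPQ => [yP|Qy].
  have := @d_uncross y c c' Q ltac:(lra) ltac:(lra) ltac:(lra).
  by rewrite -/d (dC Q) (dC c' y); lra.
have := @d_lt c c' c Q ltac:(lra) ltac:(lra) ltac:(lra) ltac:(lra).
have := @d_lt Q y c' y ltac:(lra) ltac:(lra) ltac:(lra) ltac:(lra).
by rewrite -/d; lra.
Qed.

Definition leaving (l : seq (R * R)) : Prop :=
  forall e, e \in l -> (P <= e.1 <= Q) /\ (e.2 < P \/ Q < e.2).

(** Arcs are consumed in pairs: an outer exchange followed by an inner one turns [(Q, y0)] into
    [(Q, y2)], from which the induction continues. *)
Lemma exchange_chain_le n l c0 y0 : size l = n.*2 -> leaving l ->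
  path leaving_rel (c0, y0) l -> y0 <= P \/ Q < y0 ->
  exists L1 L2, [/\ perm_eq (ends L1) (unzip1 l),
    perm_eq (ends L2) [:: Q, y0 & unzip2 l] &
    \sum_(e <- L1) d e.1 e.2 + \sum_(e <- L2) d e.1 e.2 <=
    d Q y0 + \sum_(e <- l) d e.1 e.2].
Proof.
elim: n l c0 y0 => [|n IH] [|[c1 y1] [|[c2 y2] l]] c0 y0 //= sl lv.
  move=> _ _; exists [::], [:: (Q, y0)]; split=> //.
  by rewrite !big_nil big_seq1/= addr0 add0r.
rewrite /leaving_rel/= -!andbA => /and5P[_ r1 c12 _ pl] y0PQ.
have [/=/andP[Pc1 c1Q] y1PQ] := lv (c1, y1) ltac:(by rewrite inE eqxx).
have [/=/andP[Pc2 c2Q] y2PQ] := lv (c2, y2) ltac:(by rewrite !inE eqxx orbT).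
have [] := IH l c2 y2 _ _ pl.
- by case: sl.
- by move=> e el; apply: lv; rewrite !inE el !orbT.
- by case: y2PQ; [left; apply: ltW|right].
move=> L1 [L2 [p1 p2 w]].
exists ((c1, c2) :: L1), ((y0, y1) :: L2); split=> /=.
- by rewrite !perm_cons.
- apply: (@perm_trans _ ([:: y0; y1] ++ [:: Q, y2 & unzip2 l])).
    by rewrite !perm_cons.
  by rewrite (permEl (perm_catCA [:: y0; y1] [:: Q] _)).
have [] := exchange_outer y0PQ (c := c1) _ y1PQ r1.
  by rewrite Pc1 (lt_le_trans c12).
have [] := exchange_inner Pc1 c12 c2Q y2PQ.
by rewrite !big_cons/=; lra.
Qed.

(* Walking through the arcs [c_i -> y_i] leaving [P, Q], the arc [(P, Q)] is
   exchanged successively for [(P, y_1), (c_1, c_2), (y_2, y_3), ...,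
   (c_(k-1), c_k), (y_k, Q)]; no step increases the weight. *)
Lemma exchange_chain_lt n l c0 : P < Q -> size l = n.*2 -> leaving l ->
  path leaving_rel (c0, P) l -> l != [::] -> unzip1 l != [:: P; Q] ->
  exists L1 L2, [/\ perm_eq (ends L1) (unzip1 l),
    perm_eq (ends L2) [:: Q, P & unzip2 l] &
    \sum_(e <- L1) d e.1 e.2 + \sum_(e <- L2) d e.1 e.2 <
    d P Q + \sum_(e <- l) d e.1 e.2].
Proof.
move=> PQ; case: n l => [|n] [|[c1 y1] [|[c2 y2] l]] //= sl lv.
rewrite /leaving_rel/= -!andbA => /and5P[_ r1 c12 _ pl] _ nl.
have [/=/andP[Pc1 c1Q] y1PQ] := lv (c1, y1) ltac:(by rewrite inE eqxx).
have [/=/andP[Pc2 c2Q] y2PQ] := lv (c2, y2) ltac:(by rewrite !inE eqxx orbT).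
have lvl : leaving l by move=> e el; apply: lv; rewrite !inE el !orbT.
have [] := exchange_chain_le (n := n) _ lvl pl.
- by case: sl.
- by case: y2PQ; [left; apply: ltW|right].
move=> L1 [L2 [p1 p2 w]].
exists ((c1, c2) :: L1), ((P, y1) :: L2); split=> /=.
- by rewrite !perm_cons.
- apply: (@perm_trans _ ([:: P; y1] ++ [:: Q, y2 & unzip2 l])).
    by rewrite !perm_cons.
  by rewrite (permEl (perm_catCA [:: P; y1] [:: Q] _)).
have [] := exchange_outer (or_introl (lexx P)) (c := c1) _ y1PQ r1.
  by rewrite Pc1 (lt_le_trans c12).
have [] := exchange_inner Pc1 c12 c2Q y2PQ.
rewrite !big_cons/= (dC P Q) => i1 i2 o1 o2.
have [c1P|/o2] := eqVneq c1 P; last lra.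
have [c2E|/i2] := eqVneq c2 Q; last lra.
(* Only [c1 = P] and [c2 = Q] are left; then [nl] forces a third arc, whose inner end would exceed
   [Q]. *)
case: l pl lvl nl {sl w p1 p2 lv} => [|[c3 y3] l] /=.
  by rewrite c1P c2E eqxx.
move=> /andP[/andP[/= c23 _] _] /(_ (c3, y3) ltac:(by rewrite inE eqxx)).
move=> [/= /andP[_]].
by lra.
Qed.

End Chain.

(** Minimality excludes crossings, exposure excludes an [f] around [(P, Q)], and disjointness
    excludes common ends. *)
Lemma exposed_arc_cases X M P Q f : min_perfect_matching d X M ->
  exposed M (P, Q) -> f \in M ->
  [\/ f = (P, Q), f.2 < P, Q < f.1 | P < f.1 /\ f.2 < Q].
Proof.
move=> Mmin [PQM Pexp] fM.
have [Mlt MX] := (perfect_matchingP X M).1 Mmin.1.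
have uM : uniq (ends M) by rewrite (perm_uniq MX) fset_uniq.
have [fPQ|nf] := eqVneq f (P, Q); first by constructor 1.
have := uniq_ends2 uM fM PQM nf; rewrite /= !inE !negb_or -!andbA.
case/andP => f12 /and5P[f1P f1Q f2P f2Q _].
have fl := Mlt _ fM; have /= PQ := Mlt _ PQM.
have h1 := min_matching_noncrossing Mmin fM PQM.
have h2 := min_matching_noncrossing Mmin PQM fM.
rewrite /= in h1 h2.
have h3 : ~ (f.1 <= P /\ Q <= f.2).
  move=> [a b]; apply: Pexp; exists f; split=> //=; lra.
have [?|f2P'] := ltP f.2 P; first by constructor 2.
have [?|f1Q'] := ltP Q f.1; first by constructor 3.
constructor 4; move: f1P f1Q f2P f2Q; rewrite !neq_lt.
do 4!case/orP => ?; split=> //; try lra; exfalso;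
  by [apply: h1; lra|apply: h2; lra|apply: h3; lra].
Qed.

(** The alternatives are the two equality cases of the exchange: no arc of [J] leaves [[P, Q]], or
    exactly two do, from [P] and from [Q]. *)
Lemma exposed_inner_dichotomy S X J M P Q :
  min_perfect_matching d S J -> min_perfect_matching d X M ->
  exposed M (P, Q) ->
  (forall z, P <= z <= Q -> (z \in S) = (z \in X)) ->
  (forall e, e \in J -> (P <= e.1 <= Q) = (P <= e.2 <= Q)) \/
  (forall e, e \in J -> (P < e.1 < Q) = (P < e.2 < Q)).
Proof.
move=> Jmin Mmin Mexp SX.
have [Jlt JS] := (perfect_matchingP S J).1 Jmin.1.
have [Mlt MX] := (perfect_matchingP X M).1 Mmin.1.
have uJ : uniq (ends J) by rewrite (perm_uniq JS) fset_uniq.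
have PQM := Mexp.1; have /= PQ := Mlt _ PQM.
pose p z := P <= z <= Q.
have Mp e : e \in M -> p e.1 = p e.2.
  move=> eM; have := Mlt _ eM; rewrite /p.
  have [->/=|||] := exposed_arc_cases Mmin Mexp eM; last first.
  - by move=> [? ?] ?; lra.
  - by move=> *; lra.
  - by move=> *; lra.
  - by move=> _; rewrite !lexx !(ltW PQ).
have SXp : perm_eq (filter p S) (filter p X).
  apply: uniq_perm; rewrite ?filter_uniq ?fset_uniq// => z.
  by rewrite !mem_filter; case pz: (p z) => //=; apply: SX.
pose C := sort (relpre fst <=%R) (crossing_arcs p J).
have CE : perm_eq C (crossing_arcs p J) by rewrite perm_sort.
have inE' (a : pred R) : count a (filter p X) =
    (count a (ends (inner_arcs p J)) + count a (unzip1 C))%N.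
  rewrite -(permP SXp) -(permP (perm_filter p JS)) count_ends_in.
  by congr addn; apply/esym/permP; apply: perm_map.
have outE (a : pred R) : count a (filter (predC p) S) =
    (count a (ends (outer_arcs p J)) + count a (unzip2 C))%N.
  rewrite -(permP (perm_filter (predC p) JS)) count_ends_out.
  by congr addn; apply/esym/permP; apply: perm_map.
(* [M] pairs up the points of [X] in [[P, Q]], and the inner arcs of [J] use evenly many of them, so
   evenly many remain for [C]. *)
have [n sC] : exists n, size C = n.*2.
  have := inE' predT; rewrite !count_predT size_ends !size_map => sz.
  have := size_filter_ends_even MX Mp; rewrite sz => od.
  exists (size C)./2; rewrite -[LHS]odd_double_half.
  by move: od; rewrite oddD odd_double /= => /negbTE ->.
have CP c : c \in C -> [/\ p c.1, ~~ p c.2 & c \in J \/ (c.2, c.1) \in J].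
  by rewrite (perm_mem CE); apply: crossing_arcsP.
have lvC : leaving P Q C.
  move=> c /CP[pc pc2 _]; split=> //; move: pc2.
  by rewrite /p negb_and -!ltNge => /orP[]; [left|right].
have uC : uniq (unzip1 C).
  have : uniq (ends (inner_arcs p J) ++ unzip1 C).
    rewrite (@perm_uniq _ _ (filter p X)) ?filter_uniq ?fset_uniq//.
    by apply/permP => a; rewrite count_cat inE'.
  by rewrite cat_uniq => /and3P[].
have CJ c : c \in C -> (c.2 < P -> (c.2, c.1) \in J) /\ (Q < c.2 -> c \in J).
  move=> cC; have [/andP[pc1 pc2] _] := CP _ cC.
  by case=> cJ; have := Jlt _ cJ => /= clt; split=> // ?; exfalso; lra.
(* The dummy start has its inner end below every [c_i]; its outer end [P] makes [(P, Q)] the first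
   arc to be exchanged. *)
have pathC : path (leaving_rel Q) (P - 1, P) C.
  have sortC : sorted (relpre fst <%R) C.
    rewrite -sorted_map lt_sorted_uniq_le uC /= sorted_map.
    by apply: sort_sorted => x y /=; apply: le_total.
  have sortC' : sorted (leaving_rel Q) C.
    apply: (sub_in_sorted _ _ sortC (P := mem C)); last exact/allP.
    move=> e f eC fC /= ef; rewrite /leaving_rel ef /=.
    have [eC1 eC2] := CJ _ eC; have [fC1 fC2] := CJ _ fC.
    have [/andP[e1 e2] e3] := lvC _ eC; have [/andP[f1 f2] f3] := lvC _ fC.
    have nc := min_matching_noncrossing Jmin.
    have n2 : e.2 != f.2.
      apply: contraTneq ef => ef2; rewrite -leNgt.
      case: e3 => h.
        have h' : f.2 < P by rewrite -ef2.
        have [] // : (e.2, e.1) = (f.2, f.1).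
          apply: (uniq_ends_inj uJ (eC1 h) (fC1 h') (z := e.2));
          by rewrite !inE ?ef2 eqxx.
        by move=> _ ->.
      have h' : Q < f.2 by rewrite -ef2.
      have -> // : e = f.
      apply: (uniq_ends_inj uJ (eC2 h) (fC2 h') (z := e.2));
      by rewrite !inE ?ef2 eqxx orbT.
    (* To avoid crossings, arcs leaving on the same side are nested, and one leaving to the right
       cannot precede one leaving to the left. *)
    rewrite /outer_rel; case: e3 => h.
      rewrite ltNge (ltW (lt_le_trans h (ltW PQ))) /=.
      case: f3 => h'; last by rewrite h' orbT.
      rewrite lt_neqAle eq_sym n2 /= leNgt; apply/orP; left; apply/negP => h2.
      by apply: (nc _ _ (eC1 h) (fC1 h')) => /=; lra.
    rewrite h; case: f3 => h'.
      by exfalso; apply: (nc _ _ (fC1 h') (eC2 h)) => /=; lra.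
    rewrite h' /= lt_neqAle eq_sym n2 /= leNgt; apply/negP => h2.
    by apply: (nc _ _ (eC2 h) (fC2 h')) => /=; lra.
  move: sortC' lvC; case: (C) => //= c l -> lv; rewrite andbT /leaving_rel/=.
  have [/andP[c1 c2] c3] := lv c ltac:(by rewrite inE eqxx).
  apply/andP; split; first lra.
  rewrite /outer_rel ltNge (ltW PQ) /=.
  by case: c3 => ->; rewrite ?orbT.
have [C0|nC0] := eqVneq C [::].
  left=> e eJ; apply/eqP/negPn/negP => pe.
  have : (if p e.1 then e else (e.2, e.1)) \in C.
    by rewrite (perm_mem CE); apply: map_f; rewrite mem_filter eJ andbT.
  by rewrite C0.
have [CPQ|nCPQ] := eqVneq (unzip1 C) [:: P; Q].
  right=> e eJ; apply/eqP/negPn/negP => pe.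
  (* The arcs of [J] at [P] and [Q] are the two leaving ones, so neither has both ends in
     [[P, Q]]. *)
  have boundary z : z = P \/ z = Q -> z \in [:: e.1; e.2] ->
      ~~ (p e.1 && p e.2).
    move=> zPQ ze; have : z \in unzip1 C.
      by rewrite CPQ !inE; case: zPQ => ->; rewrite eqxx ?orbT.
    case/mapP => c /CP[_ npc2 cJ] zc.
    have [c' [c'J zc' ec']] : exists c', [/\ c' \in J, z \in [:: c'.1; c'.2] &
        c.2 \in [:: c'.1; c'.2]].
      by case: cJ => cJ; [exists c|exists (c.2, c.1)];
         rewrite /= !inE zc !eqxx ?orbT.
    have ee := uniq_ends_inj uJ eJ c'J ze zc'.
    apply: contra npc2 => /andP[p1 p2]; move: ec'; rewrite -ee !inE.
    by case/orP => /eqP ->.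
  have pE z : p z = [|| z == P, z == Q | P < z < Q].
    rewrite /p !le_eqVlt (eq_sym P).
    have [->|nP] := eqVneq z P; first by rewrite PQ orbT.
    have [->|nQ] := eqVneq z Q; first by rewrite PQ.
    by [].
  have nin z : p z = false -> (P < z < Q) = false.
    by rewrite pE => /negbT/norP[_ /norP[_ /negbTE]].
  have [pp|npp] := eqVneq (p e.1) (p e.2).
    have b z : z \in [:: e.1; e.2] -> p e.1 -> (z != P) && (z != Q).
      move=> ze p1; apply/andP; split; apply/eqP => zPQ.
        by have := boundary z (or_introl zPQ) ze; rewrite -pp p1.
      by have := boundary z (or_intror zPQ) ze; rewrite -pp p1.
    have [p1|/negbTE p1] := boolP (p e.1); last first.
      by move: pe; rewrite !nin// -pp.
    have p2 : p e.2 by rewrite -pp.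
    have /andP[/negbTE a1 /negbTE a2] := b e.1 ltac:(by rewrite inE eqxx) p1.
    have /andP[/negbTE b1 /negbTE b2] :=
      b e.2 ltac:(by rewrite !inE eqxx orbT) p1.
    by move: pe p1 p2; rewrite !pE a1 a2 b1 b2 /= => /[swap] -> /[swap] ->.
  have : (if p e.1 then e else (e.2, e.1)).1 \in unzip1 C.
    apply: map_f; rewrite (perm_mem CE); apply: map_f.
    by rewrite mem_filter npp.
  have PN : (P < P < Q) = false by rewrite ltxx.
  have QN : (P < Q < Q) = false by rewrite ltxx andbF.
  rewrite CPQ !inE; case p1: (p e.1) npp; case p2: (p e.2) => //= _.
    by case/orP => /eqP ez; move: pe; rewrite ez ?PN ?QN nin.
  by case/orP => /eqP ez; move: pe; rewrite ez ?PN ?QN nin.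
exfalso.
have [A [B [pA pB]]] := exchange_chain_lt PQ sC lvC pathC nC0 nCPQ.
pose Min := [seq e <- M | p e.1].
have PQMp : (P, Q) \in Min by rewrite mem_filter PQM andbT /p /= lexx ltW.
pose H := rem (P, Q) Min.
have MpH : perm_eq Min ((P, Q) :: H) by apply: perm_to_rem.
have MpE (a : pred R) : (a P + a Q + count a (ends H))%N = count a (filter p X).
  rewrite -(permP (perm_filter p MX)) (filter_ends_closed Mp).
  by rewrite (permP (perm_ends MpH)) /= addnA.
have MnE (a : pred R) : count a (ends [seq e <- M | ~~ p e.1]) =
    count a (filter (predC p) X).
  rewrite -(permP (perm_filter (predC p) MX)).
  by rewrite (@filter_ends_closed _ (predC p))// => e /Mp /= ->.
(* Together the two competitors use all arcs of [M] and [J] except [(P, Q)] and the crossing ones,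
   which [A] and [B] replace at smaller weight. *)
have := min_perfect_matching_le dC
  (L := inner_arcs p J ++ A ++ [seq e <- M | ~~ p e.1]) Mmin.
have := min_perfect_matching_le dC (L := H ++ B ++ outer_arcs p J) Jmin.
have -> : perm_eq (ends (H ++ B ++ outer_arcs p J)) S.
  apply/permP => a; rewrite !ends_cat !count_cat (permP pB) /=.
  have /permP/(_ a) <- := permEl (perm_filterC p S).
  rewrite count_cat outE (permP SXp) -MpE.
  by move: (count _ _) (count _ _) (count _ _) (a P) (a Q); clear=> *; lia.
have -> : perm_eq (ends (inner_arcs p J ++ A ++ [seq e <- M | ~~ p e.1])) X.
  apply/permP => a; rewrite !ends_cat !count_cat (permP pA) MnE addnA -inE'.
  by have /permP/(_ a) := permEl (perm_filterC p X); rewrite count_cat.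
have wM : weight d M = d P Q + \sum_(e <- H) d e.1 e.2 +
    \sum_(e <- M | ~~ p e.1) d e.1 e.2.
  rewrite /weight (bigID (fun e => p e.1)) -big_filter.
  by rewrite (perm_big _ MpH) big_cons.
have wJ := weight_split dC p J; rewrite -(perm_big _ CE) in wJ.
move=> /(_ isT) + /(_ isT).
by rewrite wM {1}/weight wJ !big_cat /= [in X in _ -> X]big_filter; lra.
Qed.

End Exchange.

(** * Hidden arcs of a block of consecutive points *)

Section Main.
Context (R : realType).
Implicit Types (S X : {fset R}) (J M : {fset R * R}).

Lemma exists_argmin (T : eqType) (s : seq T) (A : T -> Prop) (f : T -> R) :
  (exists2 x, x \in s & A x) ->
  exists x, [/\ x \in s, A x & forall y, y \in s -> A y -> f x <= f y].
Proof.
elim: s => [[]//|a s IH] [x xs Ax].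
have [[y ys Ay]|noA] := pselect (exists2 y, y \in s & A y).
  have [z [zs Az zmin]] := IH (ex_intro2 _ _ y ys Ay).
  have [[Aa az]|na] := pselect (A a /\ f a <= f z).
    exists a; split=> // [|w]; rewrite inE ?eqxx// => /predU1P[->//|ws Aw].
    exact: le_trans az (zmin _ ws Aw).
  exists z; split=> // [|w]; rewrite inE ?zs ?orbT// => /predU1P[->|/zmin//] Aa.
  by have [//|/ltW fa] := leP (f z) (f a); case: na.
have xa : x = a.
  by move: xs; rewrite inE => /predU1P[//|xs]; case: noA; exists x.
exists a; rewrite inE eqxx -{2}xa; split=> // y.
rewrite inE => /predU1P[->//|ys Ay].
by case: noA; exists y.
Qed.

(** A longest other arc around [e] is exposed, since an arc around it would also contain [e] and be
    longer. Disjoint endpoints make the inclusions strict. *)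
Lemma hidden_in_exposed S M e : perfect_matching S M -> hidden M e ->
  exists P Q, [/\ exposed M (P, Q), P < e.1 & e.2 < Q].
Proof.
move=> /perfect_matchingP[Mlt MS] [eM neM].
have uM : uniq (ends M) by rewrite (perm_uniq MS) fset_uniq.
pose cover (e f : R * R) := f.1 <= e.1 <= f.2 /\ f.1 <= e.2 <= f.2.
have [|f [fM [fe [ef fe2]] fmin]] := @exists_argmin _ (enum_fset M)
    (fun f => f != e /\ cover e f) (fun f => f.1 - f.2).
  apply: contrapT => nf; apply: neM; split=> // -[f [fM nfe c1 c2]].
  by apply: nf; exists f.
have := uniq_ends2 uM fM eM fe; rewrite /= !inE !negb_or -!andbA.
case/andP => _ /and5P[f1e _ _ f2e _].
have elt := Mlt _ eM.
exists f.1, f.2; split; last 2 first.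
- by rewrite lt_neqAle f1e; case/andP: ef.
- by rewrite lt_neqAle eq_sym f2e; case/andP: fe2.
split; first by rewrite -surjective_pairing.
rewrite -surjective_pairing => -[h [hM nhf /andP[h1 h2] /andP[h3 h4]]].
have := uniq_ends2 uM hM fM nhf; rewrite /= !inE !negb_or -!andbA.
case/andP => _ /and5P[h1f _ _ h2f _].
have {}h1 : h.1 < f.1 by rewrite lt_neqAle h1f.
have {}h4 : f.2 < h.2 by rewrite lt_neqAle eq_sym h2f.
move/andP: ef => [? ?]; move/andP: fe2 => [? ?].
have : f.1 - f.2 <= h.1 - h.2.
  apply: fmin => //; split; last by split; lra.
  by apply/eqP => he; move: h1; rewrite he; lra.
lra.
Qed.

Variable g : R -> R.
Hypothesis g_ge0 : forall t : R, 0 <= t -> 0 <= g t.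
Hypothesis g_concave : strictly_concave g.
Hypothesis g_eq0 : forall t : R, 0 <= t -> (g t = 0 <-> t = 0).
Let d := line_dist g.

(** No arc of [M] contains or crosses the exposed one, so each has both ends left of [P] or
    neither. *)
Lemma exposed_left_even X M P Q : min_perfect_matching d X M ->
  exposed M (P, Q) -> ~~ odd (size [seq z <- X | z < P]).
Proof.
move=> Mmin Mexp; have [Mlt MX] := (perfect_matchingP X M).1 Mmin.1.
apply: (size_filter_ends_even MX) => e eM.
have := Mlt _ eM; have /= := Mlt _ Mexp.1.
have [->/=|||[]] := exposed_arc_cases g_concave Mmin Mexp eM.
- by rewrite ltxx => /ltW; rewrite leNgt => /negbTE ->.
- by move=> e2 _ e1; rewrite e2 (lt_trans e1).
- move=> e1 PQ e2; rewrite !ltNge !ltW//; last exact: lt_trans e1.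
  exact: lt_trans (lt_trans PQ e1) e2.
- move=> e1 _ _ e2; rewrite !ltNge !ltW//.
  exact: lt_trans e2.
Qed.

(** A property shared by the left and the right set inside their union, so that one argument serves
    both; the last clause feeds a parity count. *)
Definition even_block S X : Prop :=
  [/\ forall z, z \in X -> z \in S,
      forall a b z, a \in X -> b \in X -> z \in S -> a <= z <= b -> z \in X &
      forall a, a \in X ->
        ~~ odd (size [seq z <- S | (z <= a) && (z \notin X)])].

(* With [q] the indicator of an exposed interval of [M] around [e], closed if
   [J] has no arc leaving it and open otherwise, [J] and [M] can exchange their
   arcs inside [q]. In the open case some arc of [J] still covers [q]: else the
   points of [S] up to the left end, an odd number, would be matched by [J]. *)
Lemma hidden_swap S X J M e : even_block S X ->
  min_perfect_matching d S J -> min_perfect_matching d X M ->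
  hidden M e ->
  exists q : pred R, [/\ forall f, f \in J -> q f.1 = q f.2,
    forall f, f \in M -> q f.1 = q f.2,
    forall z, q z -> (z \in S) = (z \in X) &
    (forall f, f \in M -> q f.1 -> f \in J) -> e \in J /\ hidden J e].
Proof.
move=> [XS Xconv Xeven] Jmin Mmin hid.
have [Jlt JS] := (perfect_matchingP S J).1 Jmin.1.
have [Mlt MX] := (perfect_matchingP X M).1 Mmin.1.
have [P [Q [Mexp Pe eQ]]] := hidden_in_exposed Mmin.1 hid.
have uJ : uniq (ends J) by rewrite (perm_uniq JS) fset_uniq.
have [PQM _] := Mexp; have /= PQ := Mlt _ PQM.
have PX : P \in X by rewrite -(perm_mem MX) (mem_ends1 PQM).
have QX : Q \in X by rewrite -(perm_mem MX) (mem_ends2 PQM).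
have eM := hid.1; have elt := Mlt _ eM.
have SX z : P <= z <= Q -> (z \in S) = (z \in X).
  by move=> zPQ; apply/idP/idP => [zS|/XS//]; apply: Xconv PX QX zS zPQ.
have cases f := exposed_arc_cases g_concave Mmin Mexp (f := f).
have hiddenJ f : e \in J -> f \in J -> f.1 <= P -> Q <= f.2 -> hidden J e.
  move=> eJ fJ fP Qf; split=> // -[_]; apply; exists f; split=> //; try lra.
  by apply: contraTneq Pe => <-; rewrite -leNgt.
have [Jp|Jq] := exposed_inner_dichotomy g_ge0 g_concave g_eq0 Jmin Mmin Mexp SX.
  exists (fun z => P <= z <= Q); split=> // [f fM|MJ].
    have := Mlt _ fM; have [->/=|||] := cases f fM; last 3 first.
    - by move=> *; lra.
    - by move=> *; lra.
    - by move=> [? ?] ?; lra.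
    by rewrite !lexx !(ltW PQ).
  have eJ : e \in J by apply: MJ => //; lra.
  split=> //; apply: (hiddenJ (P, Q)) => //.
  by apply: MJ => //=; rewrite lexx ltW.
exists (fun z => P < z < Q); split=> // [f fM|z /andP[/ltW ? /ltW ?]|MJ].
- have := Mlt _ fM; have [->/=|||] := cases f fM; last 3 first.
  + by move=> *; lra.
  + by move=> *; lra.
  + by move=> [? ?] ?; lra.
  by rewrite !ltxx andbF.
- by apply: SX; apply/andP.
have eJ : e \in J by apply: MJ => //; lra.
split=> //.
have [[f [fJ fP Qf]]|nocover] :=
    pselect (exists f, [/\ f \in J, f.1 <= P & Q <= f.2]).
  exact: hiddenJ fJ fP Qf.
have PS := XS _ PX; have QS := XS _ QX.
(* With no covering arc, an arc of [J] passing over or starting at [P] would end inside [(P, Q)],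
   against [Jq]. *)
have Jle f : f \in J -> (f.1 <= P) = (f.2 <= P).
  move=> fJ; have f12 := Jlt _ fJ; have [f1P|f1P] := leP f.1 P; last first.
    by apply/esym/negbTE; rewrite -ltNge (lt_trans f1P).
  apply/esym; rewrite leNgt; apply/negP => Pf2.
  have [Qf2|f2Q] := leP Q f.2; first by apply: nocover; exists f.
  by have := Jq _ fJ; rewrite Pf2 f2Q => /andP[]; rewrite ltNge f1P.
have := size_filter_ends_even (p := fun z => z <= P) JS Jle.
(* [P] makes the count odd: evenly many points of [X] lie left of it, and evenly many points outside
   [X] precede it. *)
have XP : size [seq z <- S | (z <= P) && (z \in X)] =
    (size [seq z <- X | z < P]).+1.
  rewrite -[RHS]/(size (P :: [seq z <- X | z < P])); apply: perm_size.
  apply: uniq_perm; rewrite /= ?filter_uniq ?fset_uniq ?mem_filter ?ltxx//.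
  move=> z; rewrite inE !mem_filter le_eqVlt.
  have [->|_ /=] := eqVneq z P; first by rewrite PX PS.
  by case zX : (z \in X); rewrite ?andbF// (XS _ zX) andbT.
have := Xeven _ PX; have := exposed_left_even Mmin Mexp.
have -> : size [seq z <- S | z <= P] = addn
    (size [seq z <- S | (z <= P) && (z \in X)])
    (size [seq z <- S | (z <= P) && (z \notin X)]).
  rewrite -(count_predC (mem X)) !count_filter !size_filter.
  by congr addn; apply: eq_count => z /=; rewrite andbC.
by rewrite XP addSn /= oddD => /negbTE -> /negbTE ->.
Qed.

(** Giving [M] the arcs of [J] inside [q] yields a minimizer on [X], which is [M] by uniqueness; so
    [J] already has the arcs of [M] there. *)
Lemma hidden_unique S X J M e : even_block S X ->
  min_perfect_matching d S J -> min_perfect_matching d X M ->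
  (forall N, min_perfect_matching d X N -> N = M) ->
  hidden M e -> e \in J /\ hidden J e.
Proof.
move=> SX Jmin Mmin Muniq /(hidden_swap SX Jmin Mmin)[q [Jq Mq qSX]].
apply=> f fM qf; have qXS z (qz : q z) := esym (qSX z qz).
have /Muniq ME := swap_min_matching Mmin Jmin Mq Jq qXS.
by move: fM; rewrite -{1}ME mem_swap_arcs qf.
Qed.

Lemma exists_min_perfect_matching S N : perfect_matching S N ->
  exists J, min_perfect_matching d S J.
Proof.
move=> NS.
have inP J : perfect_matching S J -> J \in enum_fset (fpowerset (S `*` S)).
  move=> [JS _ _]; rewrite -[_ \in _]/(J \in fpowerset _) fpowersetE.
  by apply/fsubsetP => e /JS[e1 e2 _]; rewrite in_fsetM e1 e2.
have [|J [_ JS Jmin]] := @exists_argmin _ (enum_fset (fpowerset (S `*` S)))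
  (perfect_matching S) (weight d); first by exists N => //; apply: inP.
by exists J; split=> // N' N'S; apply: Jmin => //; apply: inP.
Qed.

End Main.

(** * Two separated point sets and their joint matching *)

Section Halves.
Context (R : realType) (g : R -> R).
Hypothesis g_ge0 : forall t : R, 0 <= t -> 0 <= g t.
Hypothesis g_concave : strictly_concave g.
Hypothesis g_eq0 : forall t : R, 0 <= t -> (g t = 0 <-> t = 0).
Let d := line_dist g.
Variables (X X' : {fset R}) (M M' : {fset R * R}).
Hypothesis X_lt_X' : forall a b, a \in X -> b \in X' -> a < b.
Hypothesis Mmin : min_perfect_matching d X M.
Hypothesis M'min : min_perfect_matching d X' M'.

Lemma even_block_left : even_block (X `|` X') X.
Proof.
split=> [z zX|a b z aX bX|a aX]; first by rewrite in_fsetU zX.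
  rewrite in_fsetU => /orP[//|zX'] /andP[_].
  by rewrite leNgt (X_lt_X' bX zX').
rewrite (@eq_in_filter _ _ pred0) ?filter_pred0// => z zS.
have : z \in X `|` X' by [].
rewrite in_fsetU; case: (z \in X) => /=; first by rewrite andbF.
by move=> zX'; rewrite andbT; apply/negbTE; rewrite -ltNge; apply: X_lt_X'.
Qed.

(** The points preceding the block are all of [X], evenly many because [M] matches them. *)
Lemma even_block_right : even_block (X `|` X') X'.
Proof.
split=> [z zX'|a b z aX' bX'|a aX']; first by rewrite in_fsetU zX' orbT.
  rewrite in_fsetU => /orP[zX|//] /andP[az _].
  by have := X_lt_X' zX aX'; rewrite ltNge az.
have -> : size [seq z <- X `|` X' | (z <= a) && (z \notin X')] =
    size (filter predT X).
  apply: perm_size; apply: uniq_perm; rewrite ?filter_uniq ?fset_uniq// => z.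
  have zS : (z \in enum_fset (X `|` X')) = (z \in X) || (z \in X').
    exact: in_fsetU.
  rewrite filter_predT mem_filter zS -[RHS]/(z \in X).
  have [zX|zX] := boolP (z \in X); last by case: (z \in X'); rewrite ?andbF.
  rewrite ltW ?X_lt_X'//= andbT; apply/negP => zX'.
  by have := X_lt_X' zX zX'; rewrite ltxx.
exact: (size_filter_ends_even ((perfect_matchingP X M).1 Mmin.1).2).
Qed.

Lemma perfect_matching_union : exists N, perfect_matching (X `|` X') N.
Proof.
have [Mlt MX] := (perfect_matchingP X M).1 Mmin.1.
have [M'lt MX'] := (perfect_matchingP X' M').1 M'min.1.
have [e||NS _] := @perfect_matching_seq_fset R (X `|` X') (M ++ M').
- by rewrite mem_cat => /orP[/Mlt|/M'lt].
- rewrite ends_cat; apply: (@perm_trans _ (X ++ X')); first exact: perm_cat.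
  apply: uniq_perm => [||z]; rewrite ?fset_uniq//.
    rewrite cat_uniq !fset_uniq andbT /=; apply/hasPn => z zX'.
    by apply/negP => zX; have := X_lt_X' zX zX'; rewrite ltxx.
  by rewrite mem_cat; apply/esym; apply: in_fsetU.
- by eexists; exact: NS.
Qed.

(* Among the minimizing joint matchings, one sharing the most arcs with the
   partial matchings works: a further swap would increase this number. *)
Lemma hidden_compatible_choice : exists J,
  [/\ min_perfect_matching d (X `|` X') J,
      forall e, hidden M e -> e \in J /\ hidden J e &
      forall e, hidden M' e -> e \in J /\ hidden J e].
Proof.
have [N0 N0S] := perfect_matching_union.
have [J0 J0min] := exists_min_perfect_matching g N0S.
pose U := M `|` M'.
pose common (J : {fset R * R}) := #|` J `&` U|.
have [J Jmin Jmax] : exists2 J, min_perfect_matching d (X `|` X') J &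
    forall J', min_perfect_matching d (X `|` X') J' ->
      (common J' <= common J)%N.
  have : exists n, `[< exists2 J, min_perfect_matching d (X `|` X') J &
      common J = n >].
    by exists (common J0); apply/asboolP; exists J0.
  move=> ex; case: (ex_maxnP ex (m := #|` U|)) => [n /asboolP[J _ <-]|].
    by apply: fsubset_leq_card; apply: fsubsetIr.
  move=> n /asboolP[J Jmin <-] Jmax; exists J => // J' J'min.
  by apply: Jmax; apply/asboolP; exists J'.
(* By maximality, a minimizer keeping every arc that [J] shares with [U] shares no further one. *)
have swapped J' : min_perfect_matching d (X `|` X') J' ->
    J `&` U `<=` J' -> J' `&` U `<=` J.
  move=> J'min sub.
  have sub' : J `&` U `<=` J' `&` U by rewrite fsubsetI sub fsubsetIr.
  have /eqP <- : J `&` U == J' `&` U by rewrite eqEfcard sub' Jmax.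
  exact: fsubsetIl.
have [[MX _ _] _] := Mmin; have [[MX' _ _] _] := M'min.
have disj z : z \in X -> z \in X' -> False.
  by move=> zX zX'; have := X_lt_X' zX zX'; rewrite ltxx.
have choiceP Y N e : even_block (X `|` X') Y -> min_perfect_matching d Y N ->
    N `<=` U -> (forall h, h \in U -> h.1 \in Y -> h \in N) ->
    hidden N e -> e \in J /\ hidden J e.
  move=> SY Nmin /fsubsetP NU UY hid.
  have [q [Jq Nq qSY]] := hidden_swap g_ge0 g_concave g_eq0 SY Jmin Nmin hid.
  apply=> f fN qf; have J'min := swap_min_matching Jmin Nmin Jq Nq qSY.
  apply: (fsubsetP (swapped _ J'min _)); last first.
    by rewrite in_fsetI mem_swap_arcs qf fN NU.
  (* A shared arc inside [q] starts in [Y], hence belongs to [N] and survives the swap. *)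
  apply/fsubsetP => h; rewrite in_fsetI mem_swap_arcs => /andP[hJ hU].
  case: ifP => // qh; apply: UY => //; rewrite -(qSY _ qh).
  by have [[JS _ _] _] := Jmin; have [] := JS _ hJ.
exists J; split=> // e.
  apply: (choiceP X M) => //; [exact: even_block_left|exact: fsubsetUl|].
  by move=> h; rewrite in_fsetU => /orP[//|/MX'[h1 _ _] /disj/(_ h1)].
apply: (choiceP X' M') => //; [exact: even_block_right|exact: fsubsetUr|].
by move=> h; rewrite in_fsetU => /orP[/MX[h1 _ _] /(disj _ h1)|//].
Qed.

End Halves.

Theorem theorem5 (R : realType) (g : R -> R)
    (g_ge0 : forall t : R, 0 <= t -> 0 <= g t)
    (g_concave : strictly_concave g)
    (g_eq0 : forall t : R, 0 <= t -> (g t = 0 <-> t = 0))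
    (n n' : nat) (x : 'I_(2 * n) -> R) (x' : 'I_(2 * n') -> R)
    (x_incr : forall i j : 'I_(2 * n), (i < j)%N -> x i < x j)
    (x'_incr : forall i j : 'I_(2 * n'), (i < j)%N -> x' i < x' j)
    (x_lt_x' : forall i i', x i < x' i') :
  let d := line_dist g in
  let X := point_set x in
  let X' := point_set x' in
  (* the literal claim, for partial matchings that are the unique minimizers,
     and for every minimizing joint matching *)
  (forall M M' J : {fset R * R},
     min_perfect_matching d X M ->
     min_perfect_matching d X' M' ->
     min_perfect_matching d (X `|` X') J ->
     ((forall N, min_perfect_matching d X N -> N = M) ->
      forall i j, hidden M (x i, x j) ->
        (x i, x j) \in J /\ hidden J (x i, x j)) /\
     ((forall N, min_perfect_matching d X' N -> N = M') ->
      forall i j, hidden M' (x' i, x' j) ->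
        (x' i, x' j) \in J /\ hidden J (x' i, x' j)))
  /\
  (* in case of ties: any choice of minimizing partial matchings is compatible
     with some choice of the minimizing joint matching *)
  (forall M M' : {fset R * R},
     min_perfect_matching d X M ->
     min_perfect_matching d X' M' ->
     exists J : {fset R * R},
       [/\ min_perfect_matching d (X `|` X') J,
           forall i j, hidden M (x i, x j) ->
             (x i, x j) \in J /\ hidden J (x i, x j) &
           forall i j, hidden M' (x' i, x' j) ->
             (x' i, x' j) \in J /\ hidden J (x' i, x' j)]).
Proof.
move=> d X X'.
have XX' a b : a \in X -> b \in X' -> a < b.
  by move=> /imfsetP[i _ ->] /imfsetP[i' _ ->]; apply: x_lt_x'.
split=> [M M' J Mmin M'min Jmin|M M' Mmin M'min].
  split=> uniq i j hid.
    have XS := even_block_left XX'.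
    exact: (hidden_unique g_ge0 g_concave g_eq0 XS Jmin Mmin uniq hid).
  have X'S := even_block_right XX' Mmin.
  exact: (hidden_unique g_ge0 g_concave g_eq0 X'S Jmin M'min uniq hid).
have [J [Jmin JM JM']] :=
  hidden_compatible_choice g_ge0 g_concave g_eq0 XX' Mmin M'min.
by exists J; split=> // i j; [apply: JM|apply: JM'].
Qed.
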